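(* Pure finite-memory winning strategies can be traded for equally powerful randomized memoryless ones in one-player multi mean-payoff parity games, for both satisfaction and expectation semantics: in every one-player game $G_p$ and for every $v\in\mathbb Q^k$, $\alpha\in[0,1]$, $\beta\in\mathbb Q^k$, if a pure finite-memory strategy of $\mathcal P_1$ satisfies $\alpha$-satisfaction for $\mathsf{MeanPayoff}(v)\cap\mathsf{Parity}$ and $\beta$-expectation for $\mathsf{MP}$, then there is a randomized memoryless strategy of $\mathcal P_1$ that also satisfies $\alpha$-satisfaction for $\mathsf{MeanPayoff}(v)\cap\mathsf{Parity}$ and $\beta$-expectation for $\mathsf{MP}$. For two-player games, randomized memoryless strategies are not as powerful, even limited to expectation semantics, no parity condition, and only $2$ dimensions: there exist a two-player game with $k=2$ (without parity) and a threshold $\beta\in\mathbb Q^2$ such that $\mathcal P_1$ has a pure finite-memory strategy satisfying $\beta$-expectation for $\mathsf{MP}$, but no randomized memoryless strategy of $\mathcal P_1$ satisfies $\beta$-expectation for $\mathsf{MP}$.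
   Context: A game $G_p=(S_1,S_2,s_{init},E,k,w,p)$ consists of finite disjoint sets $S_1,S_2$ of states of player 1 ($\mathcal P_1$) and player 2 ($\mathcal P_2$), $S=S_1\cup S_2$, $s_{init}\in S$, $E\subseteq S\times S$ such that every state has a successor, $k\in\mathbb N$, $w:E\to\mathbb Z^k$, $p:S\to\mathbb N$. It is one-player if $S_2=\emptyset$. A play is an infinite path $\pi=s_0s_1\dots$ with $s_0=s_{init}$; $\mathsf{MP}(\pi)=\liminf_{n\to\infty}\frac1n\sum_{i<n}w(s_i,s_{i+1})$, componentwise; vectors are compared componentwise. $\mathsf{MeanPayoff}(v)=\{\pi:\mathsf{MP}(\pi)\ge v\}$; $\mathsf{Parity}$ is the set of plays whose least priority visited infinitely often is even. A strategy of $\mathcal P_i$ maps finite prefixes ending in $S_i$ to distributions over successors of the last state; pure means Dirac distributions, memoryless means depending only on the last state; a pure strategy is finite-memory if encoded by a finite deterministic Moore machine. Strategies $\lambda_1,\lambda_2$ induce a probability measure $\mathbb P^{\lambda_1,\lambda_2}_{s_{init}}$ on plays, with expectation $\mathbb E^{\lambda_1,\lambda_2}_{s_{init}}$. $\lambda_1$ satisfies $\alpha$-satisfaction for $\phi$ if $\mathbb P^{\lambda_1,\lambda_2}_{s_{init}}(\phi)\ge\alpha$ for all strategies $\lambda_2$ of $\mathcal P_2$, and $\beta$-expectation for $\mathsf{MP}$ if $\mathbb E^{\lambda_1,\lambda_2}_{s_{init}}(\mathsf{MP})\ge\beta$ for all $\lambda_2$. *)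

(* Defs.v *)
From HB Require Import structures.
From mathcomp Require Import all_boot all_order all_algebra.
From mathcomp Require Import all_classical all_reals all_analysis.

Set Implicit Arguments.
Unset Strict Implicit.
Unset Printing Implicit Defensive.

Import Order.TTheory GRing.Theory Num.Theory.
Import numFieldNormedType.Exports.

Local Open Scope classical_set_scope.
Local Open Scope ring_scope.

Variant player := P1 | P2.

(* Only the weights of pairs [edge s t] are meaningful. *)
Record game (k : nat) := Game {
  state :> finType;
  owner : state -> player;
  init : state;
  edge : rel state;
  edge_total : forall s, exists t, edge s t;
  weight : state -> state -> 'rV[int]_k
}.

Record parity_game (k : nat) := ParityGame {
  arena :> game k;
  priority : arena -> nat
}.

Definition one_player k (G : game k) := forall s : G, owner s = P1.

Section Plays.
Context {k : nat} (G : game k).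

Definition is_play (pi : nat -> G) :=
  pi 0%N = init G /\ forall n, edge (pi n) (pi n.+1).

Definition play_prefix (h : seq G) :=
  (ohead h == Some (init G)) && sorted (@edge k G) h.

Definition MP (R : realType) (pi : nat -> G) (j : 'I_k) : \bar R :=
  limn_einf (fun n =>
    (n%:R^-1 * \sum_(i < n) (weight (pi i) (pi i.+1) 0 j)%:~R)%:E).

Definition MeanPayoff (R : realType) (v : 'rV[rat]_k) : set (nat -> G) :=
  [set pi | is_play pi /\ forall j, ((ratr (v 0 j))%:E <= MP R pi j)%E].

End Plays.

Section Parity.
Context {k : nat} (G : parity_game k).

Definition inf_often (pi : nat -> G) (c : nat) :=
  forall n, exists2 m, (n <= m)%N & priority (pi m) = c.

Definition Parity : set (nat -> G) :=
  [set pi | is_play pi /\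
    exists c, [/\ ~~ odd c, inf_often pi c
                & forall d, inf_often pi d -> (c <= d)%N]].

End Parity.

Section Strategies.
Context {k : nat} (R : realType) (G : game k).

Definition distribution_on (A : pred G) (d : G -> R) :=
  [/\ forall t, 0 <= d t, \sum_t d t = 1 & forall t, ~~ A t -> d t = 0].

(* The values of a strategy outside the prefixes of plays that end in a state
   of its player are junk: they are unconstrained, and never used. *)
Record strategy (i : player) := Strategy {
  choice_of :> seq G -> G -> R;
  strategyP : forall h s, play_prefix (rcons h s) -> owner s = i ->
    distribution_on (edge s) (choice_of (rcons h s))
}.

Definition memoryless i (l : strategy i) :=
  forall h h' s, play_prefix (rcons h s) -> play_prefix (rcons h' s) ->
    owner s = i -> l (rcons h s) = l (rcons h' s).

Record moore_machine := MooreMachine {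
  memory : finType;
  memory_init : memory;
  memory_update : memory -> G -> memory;
  next_action : memory -> G -> G
}.

(* The memory is updated with the states already left, the action is chosen
   from the memory and the current state. *)
Definition encodes i (M : moore_machine) (l : strategy i) :=
  forall h s, play_prefix (rcons h s) -> owner s = i ->
    forall t, l (rcons h s) t =
      (t == next_action (foldl (@memory_update M) (memory_init M) h) s)%:R.

Definition pure_finite_memory i (l : strategy i) :=
  exists M : moore_machine, encodes M l.

Definition step (l1 : strategy P1) (l2 : strategy P2) (h : seq G) : G -> R :=
  match owner (last (init G) h) with P1 => l1 h | P2 => l2 h end.

End Strategies.

Section Measure.
Context {k : nat} (G : game k).

Definition path_of : Type := nat -> G.
HB.instance Definition _ := gen_eqMixin path_of.
HB.instance Definition _ := gen_choiceMixin path_of.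
HB.instance Definition _ := isPointed.Build path_of (fun=> init G).

Definition cylinder (h : seq G) : set path_of :=
  [set pi | mkseq pi (size h) = h].

(* All infinite sequences of states, with the sigma-algebra generated by the
   cylinders; those that are not plays form a null set of [play_measure]. *)
Definition paths := g_sigma_algebraType (range cylinder).

Lemma measurable_cylinder h : measurable (cylinder h : set paths).
Proof. by apply: sub_sigma_algebra; exists h. Qed.

Lemma cylinder_nil : cylinder [::] = setT.
Proof. by apply/seteqP; split. Qed.

Lemma sub_cylinder_rcons h t : cylinder (rcons h t) `<=` cylinder h.
Proof.
move=> pi; rewrite /cylinder /= size_rcons /mkseq -addn1 iotaD map_cat /=.
by rewrite cats1 => /rcons_inj[].
Qed.

End Measure.

Section Sampling.
Context {R : realType} {k : nat} (G : game k) (q : seq G -> G -> R).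
Hypothesis q_ge0 : forall h t, 0 <= q h t.
Hypothesis q_sum1 : forall h, \sum_t q h t = 1.

Let i0 := init G.
Let cum h j : R := \sum_(i < j) q h (nth i0 (enum G) i).

Let cum_le h i j : (i <= j)%N -> cum h i <= cum h j.
Proof.
move=> /subnK <-; elim: (j - i)%N => [|n IHn]; first by rewrite add0n.
by rewrite addSn (le_trans IHn)// /cum big_ord_recr /= lerDl.
Qed.

Let cumT h : cum h #|G| = 1.
Proof.
rewrite /cum -(q_sum1 h) [RHS](reindex_onto enum_val enum_rank) /=; last first.
  by move=> i _; rewrite enum_rankK.
apply: eq_big => [i|i _]; first by rewrite enum_valK eqxx.
by rewrite (enum_val_nth i0).
Qed.

(* The paths starting from the initial state are sampled from a real u in
   [0, 1[, by splitting the interval of each finite prefix h into consecutive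
   intervals of lengths proportional to the q h t. *)
Let next (h : seq G) (xw : R * R) (t : G) :=
  (xw.1 + xw.2 * cum h (enum_rank t), xw.2 * q h t).
Let mem (xw : R * R) (u : R) := xw.1 <= u < xw.1 + xw.2.

Let next_mem h xw u : mem xw u -> exists t, mem (next h xw t) u.
Proof.
case: xw => x w /andP[/= xu uxw].
have ex : exists j, u < x + w * cum h j by exists #|G|; rewrite cumT mulr1.
case: (ex_minnP ex) => -[|j] uj jmin.
  by move: uj; rewrite /cum big_ord0 mulr0 addr0 ltNge xu.
have jG : (j < #|G|)%N by apply: jmin; rewrite cumT mulr1.
exists (enum_val (Ordinal jG)); rewrite /mem /next enum_valK /=.
apply/andP; split; first by rewrite leNgt; apply/negP => /jmin; rewrite ltnn.
move: uj; rewrite /cum big_ord_recr /= mulrDr addrA.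
by rewrite (enum_val_nth i0).
Qed.

Let next_uniq h xw u t t' : 0 <= xw.2 ->
  mem (next h xw t) u -> mem (next h xw t') u -> t = t'.
Proof.
case: xw => x w /= w0.
wlog tt' : t t' / (enum_rank t <= enum_rank t')%N => [H|].
  case: (leqP (enum_rank t) (enum_rank t')) => [/H//|/ltnW /H tt' a b].
  by rewrite (tt' b a).
move: tt'; rewrite leq_eqVlt => /predU1P[/ord_inj/enum_rank_inj//|].
move=> /(cum_le h) /(ler_wpM2l w0); rewrite {1}/cum big_ord_recr /=.
rewrite -(enum_val_nth i0) enum_rankK mulrDr -/(cum h _) => tt'.
move=> /andP[/= _ ut] /andP[/= t'u _].
by have := le_lt_trans t'u ut; rewrite -addrA ltrD2l ltNge tt'.
Qed.

Let itv_rev := fix itv_rev (r : seq G) : R * R :=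
  if r is t :: r' then
    if r' is [::] then (0, 1) else next (rev r') (itv_rev r') t
  else (0, 1).
Let itv h := itv_rev (rev h).

Let itv_rcons h t : h != [::] -> itv (rcons h t) = next h (itv h) t.
Proof.
move=> h0; rewrite /itv rev_rcons /=; case E : (rev h) => [|x r].
  by move: h0; rewrite -(revK h) E.
by rewrite -E revK.
Qed.

Let itv_bounds h : [/\ 0 <= (itv h).1, 0 <= (itv h).2 & (itv h).1 + (itv h).2 <= 1].
Proof.
elim/last_ind: h => [|h t [x0 w0 xw1]]; first by rewrite /itv /= add0r.
have [->|h0] := eqVneq h [::]; first by rewrite /itv /= add0r.
rewrite itv_rcons // /next /=; set j := enum_rank t.
have cumj : cum h j + q h t <= 1.
  rewrite -(cumT h) (le_trans _ (cum_le h (ltn_ord j)))//.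
  by rewrite /cum big_ord_recr /= -(enum_val_nth i0) enum_rankK.
split; [|exact: mulr_ge0|]; rewrite /=.
- by rewrite addr_ge0// mulr_ge0// sumr_ge0.
- by rewrite -addrA -mulrDr (le_trans _ xw1)// lerD2l ler_piMr.
Qed.

Let pre u := fix pre n : seq G :=
  if n is n'.+1 then
    rcons (pre n') (odflt i0 [pick t | mem (itv (rcons (pre n') t)) u])
  else [:: i0].
Let sample (u : measurableTypeR R) : paths G := fun n => last i0 (pre u n).

Let pre_neq0 u n : pre u n != [::].
Proof. by case: n => //= n; case: (pre u n). Qed.

Let mkseq_sample u n : mkseq (sample u) n.+1 = pre u n.
Proof.
elim: n => // n IHn.
rewrite /mkseq -addn1 iotaD map_cat -/(mkseq _ _) IHn /= cats1 add0n.
by congr rcons; rewrite /sample /= last_rcons.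
Qed.

Let pre_mem u n : mem (0, 1) u -> mem (itv (pre u n)) u.
Proof.
move=> u01; elim: n => [//|n IHn /=].
case: pickP => [//|np]; have [t] := next_mem (pre u n) IHn.
by rewrite -itv_rcons ?pre_neq0// => ut; have := np t; rewrite /= ut.
Qed.

Let pre_eq u h : mem (itv h) u -> ohead h = Some i0 -> pre u (size h).-1 = h.
Proof.
elim/last_ind: h => // h t IHh.
have [->|h0] := eqVneq h [::]; first by move=> _ [->].
have [_ w0 _] := itv_bounds h.
move=> ut hd; have hhd : ohead h = Some i0 by case: (h) h0 hd.
have uh : mem (itv h) u.
  have [_ wt _] := itv_bounds (rcons h t).
  move: ut; rewrite itv_rcons // /mem /next /= => /andP[a b].
  apply/andP; split.
    by rewrite (le_trans _ a)// lerDl mulr_ge0// sumr_ge0.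
  rewrite (lt_le_trans b)// -addrA -mulrDr lerD2l ler_piMr//.
  rewrite -(cumT h) (le_trans _ (cum_le h (ltn_ord (enum_rank t))))//.
  by rewrite /cum big_ord_recr /= -(enum_val_nth i0) enum_rankK.
have := IHh uh hhd; case E : (size h) => [|n]; first by case: (h) h0 E.
rewrite size_rcons E /= => ->; congr rcons.
case: pickP => [t' /=|/(_ t)]; last by rewrite ut.
by move: ut; rewrite !itv_rcons//= => ut ut'; apply: (next_uniq w0 ut' ut).
Qed.

Let mem01 h u : mem (itv h) u -> mem (0, 1) u.
Proof.
have [x0 w0 xw1] := itv_bounds h; rewrite /mem /= add0r => /andP[a b].
by rewrite (le_trans x0 a) (lt_le_trans b xw1).
Qed.

Let sample_out u : ~~ mem (0, 1) u -> sample u = fun=> i0.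
Proof.
move=> u01; apply/funext => -[|n] //; rewrite /sample /= last_rcons.
by case: pickP => [t /mem01|//]; rewrite (negbTE u01).
Qed.

Let sample_preimage h : ohead h = Some i0 ->
  sample @^-1` cylinder h `&` [set` `[0, 1[] =
  [set` `[(itv h).1, (itv h).1 + (itv h).2[].
Proof.
move=> hd; have h0 : (size h).-1.+1 = size h by case: (h) hd.
apply/seteqP; split => u /=; rewrite /cylinder /= !in_itv /= -h0 mkseq_sample.
  by case=> <- u01; apply: pre_mem; rewrite /mem /= add0r.
move=> uh; split; first exact: pre_eq.
by have := mem01 uh; rewrite /mem /= add0r.
Qed.

Let measurable_sample : measurable_fun setT sample.
Proof.
apply: (@measurability _ _ _ (paths G) setT sample (range (@cylinder k G)) erefl).
move=> _ [_ [h _ <-] <-]; rewrite setTI.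
rewrite -(setIT (_ @^-1` _)) -(setUv [set` `[0, 1[]) setIUr.
apply: measurableU; last first.
  have [hi|hi] := pselect (cylinder h (fun=> i0)).
    rewrite setIidr; first by apply: measurableC; exact: measurable_itv.
    move=> u /= u01; rewrite sample_out// /mem /= add0r.
    by apply/negP; rewrite in_itv in u01.
  rewrite (_ : _ `&` _ = set0)//; apply/seteqP; split => // u [/=].
  rewrite in_itv => + u01; rewrite sample_out// /mem /= add0r.
  by apply/negP.
have [hd|hd] := pselect (ohead h = Some i0).
  by rewrite sample_preimage//; exact: measurable_itv.
case: h hd => [|x h] hd.
  by rewrite cylinder_nil preimage_setT setTI; exact: measurable_itv.
rewrite (_ : _ `&` _ = set0)//; apply/seteqP; split => // u [/=].
rewrite /cylinder /= => /(congr1 ohead) /= [xi _].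
by apply: hd; rewrite /= -xi.
Qed.

Let m01 : measurable ([set` `[0, 1[%R] : set (measurableTypeR R)).
Proof. exact: measurable_itv. Qed.

Let lebesgue01 := mrestr (@lebesgue_measure R) m01.

Let lebesgue01_setT : lebesgue01 setT = 1%E.
Proof.
by rewrite /lebesgue01 /mrestr setTI lebesgue_measure_itv /= lte_fin ltr01 oppr0 adde0.
Qed.

HB.instance Definition _ := Measure.on lebesgue01.
HB.instance Definition _ :=
  Measure_isProbability.Build _ _ _ lebesgue01 lebesgue01_setT.

Lemma sampling_exists : exists mu : probability (paths G) R,
  mu (cylinder [:: init G]) = 1%E /\
  forall h t, ohead h = Some (init G) ->
    mu (cylinder (rcons h t)) = (mu (cylinder h) * (q h t)%:E)%E.
Proof.
pose X : {mfun measurableTypeR R >-> paths G} :=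
  HB.pack sample (isMeasurableFun.Build _ _ _ _ sample measurable_sample).
pose mu : probability (paths G) R := distribution lebesgue01 X; exists mu.
have E h : ohead h = Some i0 -> mu (cylinder h) = (itv h).2%:E.
  move=> hd; rewrite /mu /= /distribution /pushforward /= /lebesgue01 /mrestr.
  have [_ w0 _] := itv_bounds h.
  rewrite sample_preimage// lebesgue_measure_itv /= lte_fin ltrDl.
  move: w0; rewrite le_eqVlt => /predU1P[<-|->]; first by rewrite ltxx.
  by rewrite -EFinB addrAC subrr add0r.
split=> [|h t hd]; first by rewrite E.
rewrite !E//; last by case: (h) hd.
by rewrite itv_rcons//; case: (h) hd.
Qed.

End Sampling.

Section PlayMeasure.
Context {R : realType} {k : nat} {G : game k}.
Variables (l1 : strategy R G P1) (l2 : strategy R G P2).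

Lemma play_prefix_rcons (h : seq G) t : h != [::] ->
  play_prefix (rcons h t) = play_prefix h && edge (last (init G) h) t.
Proof.
by case: h => // s h _; rewrite /play_prefix /= rcons_path andbA.
Qed.

Lemma step_distribution (h : seq G) : play_prefix h ->
  distribution_on (edge (last (init G) h)) (step l1 l2 h).
Proof.
case/lastP: h => // h s ph; rewrite /step last_rcons.
by case E : (owner s); [exact: (strategyP l1 ph E)|exact: (strategyP l2 ph E)].
Qed.

(* The Markov property on cylinders, which determines the measure. *)
Definition induced (mu : probability (paths G) R) :=
  mu (cylinder [:: init G]) = 1%E /\
  forall h t, play_prefix h ->
    mu (cylinder (rcons h t)) = (mu (cylinder h) * (step l1 l2 h t)%:E)%E.

Lemma induced_exists : exists mu, induced mu.
Proof.
pose q h t : R := if play_prefix h then step l1 l2 h t else (t == init G)%:R.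
have q_ge0 h t : 0 <= q h t.
  by rewrite /q; case: ifP => [ph|//]; have [] := step_distribution ph.
have q_sum1 h : \sum_t q h t = 1.
  rewrite /q; case: (boolP (play_prefix h)) => [ph|_].
    by have [] := step_distribution ph.
  by rewrite (bigD1 (init G)) //= eqxx big1 ?addr0// => t /negPf ->.
have [mu [mu1 muS]] := sampling_exists q_ge0 q_sum1.
exists mu; split=> // h t ph; rewrite muS /q ?ph//.
by case/andP: ph => /eqP.
Qed.

Definition play_measure : probability (paths G) R := projT1 (cid induced_exists).

Lemma play_measureP : induced play_measure.
Proof. exact: projT2 (cid induced_exists). Qed.

Lemma induced_unique (mu : probability (paths G) R) : induced mu ->
  forall A, measurable A -> mu A = play_measure A.
Proof.
move=> indmu; have indP := play_measureP.
have null (nu : probability (paths G) R) h : induced nu -> h != [::] ->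
    ~~ play_prefix h -> nu (cylinder h) = 0%E.
  move=> [nu1 nuS]; elim/last_ind: h => // h t IHh _.
  have [->|h0] := eqVneq h [::].
    rewrite /play_prefix /= andbT => ti.
    apply/eqP; rewrite eq_le measure_ge0 andbT.
    rewrite (_ : 0%E = nu (~` cylinder [:: init G])); last first.
      by rewrite probability_setC ?nu1 ?subee//; exact: measurable_cylinder.
    apply: le_measure; rewrite ?inE; try exact: measurable_cylinder.
      by apply: measurableC; exact: measurable_cylinder.
    move=> pi; rewrite /cylinder /mkseq /= => -[pi0] -[pi0'].
    by move: ti; rewrite -pi0 pi0' eqxx.
  rewrite play_prefix_rcons// negb_and; case: (boolP (play_prefix h)) => ph.
    move=> /= et; rewrite nuS//.
    by have [_ _ ->//] := step_distribution ph; rewrite mule0.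
  move=> _; apply/eqP; rewrite eq_le measure_ge0 andbT -(IHh h0 ph).
  apply: le_measure; rewrite ?inE; try exact: measurable_cylinder.
  exact: sub_cylinder_rcons.
have eq_cyl h : mu (cylinder h) = play_measure (cylinder h).
  elim/last_ind: h => [|h t IHh]; first by rewrite cylinder_nil !probability_setT.
  have [pht|npht] := boolP (play_prefix (rcons h t)); last first.
    by rewrite !null//; case: (h).
  move: pht; have [->|h0] := eqVneq h [::].
    by rewrite /play_prefix /= andbT => /eqP[->]; rewrite indmu.1 indP.1.
  by rewrite play_prefix_rcons// => /andP[ph _]; rewrite indmu.2// indP.2// IHh.
move=> A mA.
pose C : set (set (paths G)) := [set X | X = set0 \/ range (@cylinder k G) X].
apply: (@g_sigma_algebra_measure_unique _ R (paths G) C _ (fun=> setT)).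
- by move=> X [->//|[h _ <-]]; exact: measurable_cylinder.
- by move=> _; right; exists [::] => //; exact: cylinder_nil.
- by apply/seteqP; split => // x _; exists 0%N.
- have nest h h' : (size h <= size h')%N ->
      cylinder h `&` cylinder h' = set0 \/ cylinder h `&` cylinder h' = cylinder (G:=G) h'.
    move=> hh'.
    have tk (pi : nat -> G) : take (size h) (mkseq pi (size h')) = mkseq pi (size h).
      by rewrite /mkseq -map_take take_iota; move/minn_idPl: hh' => ->.
    have [E|/eqP E] := eqVneq (take (size h) h') h; [right|left].
      apply/setIidPr => pi; rewrite /cylinder /= => pih'.
      by rewrite -tk pih'.
    apply/seteqP; split => // pi [] /=; rewrite /cylinder /= => pih pih'.
    by apply: E; rewrite -{1}pih' tk.
  move=> X Y [->|[h _ <-]]; first by rewrite set0I; left.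
  move=> [->|[h' _ <-]]; first by rewrite setI0; left.
  wlog hh' : h h' / (size h <= size h')%N => [H|].
    by case: (leqP (size h) (size h')) => [/H//|/ltnW/H]; rewrite setIC.
  by have [->|->] := nest _ _ hh'; [left|right; exists h'].
- by move=> X [->|[h _ <-]]; [rewrite !measure0|exact: eq_cyl].
- by move=> _ /=; rewrite probability_setT ltry.
- have sub : range (@cylinder k G) `<=` C by move=> X; right.
  exact: (@sub_sigma_algebra2 _ setT _ _ sub A mA).
Qed.

End PlayMeasure.

Section Objectives.
Context {R : realType} {k : nat} {G : game k}.

Definition satisfaction (l1 : strategy R G P1) (alpha : R)
    (phi : set (nat -> G)) :=
  forall l2 : strategy R G P2, (alpha%:E <= play_measure l1 l2 phi)%E.

Definition expectation_MP (l1 : strategy R G P1) (beta : 'rV[rat]_k) :=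
  forall (l2 : strategy R G P2) (j : 'I_k),
    ((ratr (beta 0 j))%:E
       <= \int[play_measure l1 l2]_(pi in setT) MP R (pi : nat -> G) j)%E.

End Objectives.

(* Main.v *)
Require Import Defs.
From mathcomp Require Import all_boot all_order all_algebra.
From mathcomp Require Import all_classical all_reals all_analysis.
From mathcomp Require Import measurable_realfun zify ring lra.

(** In a one-player game a pure finite-memory strategy produces a single play,
which is ultimately periodic. The randomized memoryless strategy follows, from a
transient state of this play, the edge taken at its last visit, and from a state
of the cycle, each edge with its frequency in the cycle. The resulting Markov
chain almost surely enters the cycle, stays in it, visits all its states
infinitely often, and has the mean payoff of the cycle: by a solution of the
Poisson equation, the deviation of the payoff from this mean is, up to a bounded
error, a martingale with bounded increments, which obeys a strong law of large
numbers (fourth moments and Borel-Cantelli).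

In the two-player game, each round consists of a choice of player 2 and then a
choice of player 1 between the payoffs (1, -1) and (-1, 1). A strategy that
remembers the choice of player 2 and plays the opposite one keeps all partial
sums bounded. A memoryless one picks both payoffs with fixed probabilities, and
one of the two constant strategies of player 2 then makes one of the two
dimensions negative. *)

Set Implicit Arguments.
Unset Strict Implicit.
Unset Printing Implicit Defensive.

Import Order.TTheory GRing.Theory Num.Theory.
Import numFieldNormedType.Exports.

Local Open Scope classical_set_scope.
Local Open Scope ring_scope.

(** * Measurability of the objectives *)

Section PrefixEvents.
Context {k : nat} (G : game k).

(** There are only countably many finite sequences of states, so an event decided by the first [n]
    states is a countable union of cylinders. *)
Lemma measurable_prefix (n : nat) (Q : set (seq G)) :
  measurable ([set pi | Q (mkseq pi n)] : set (paths G)).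
Proof.
pose F (h : seq G) : set (paths G) :=
  if `[< Q h /\ size h = n >] then cylinder h else set0.
rewrite (_ : [set pi | _] = \bigcup_h F h).
  apply: countable_bigcupT_measurable => [|h]; first exact: countableP.
  by rewrite /F; case: asboolP => // _; exact: measurable_cylinder.
apply/seteqP; split => [pi /= Qpi|pi [h _]].
  by exists (mkseq pi n) => //; rewrite /F size_mkseq asboolT// /cylinder /= size_mkseq.
by rewrite /F; case: asboolP => // -[Qh <-]; rewrite /cylinder /= => ->.
Qed.

Lemma measurable_prefix_fun d (T : measurableType d) (n : nat) (F : seq G -> T) :
  measurable_fun setT (fun pi : paths G => F (mkseq pi n)).
Proof.
move=> _ B _; rewrite setTI.
exact: (@measurable_prefix n [set h | B (F h)]).
Qed.

Lemma mkseq_rcons (pi : nat -> G) n : mkseq pi n.+1 = rcons (mkseq pi n) (pi n).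
Proof. by rewrite /mkseq -addn1 iotaD map_cat cats1. Qed.

Lemma is_playE : @is_play k G =
  [set pi | forall n, play_prefix (mkseq pi n.+1)].
Proof.
have prefixE (pi : nat -> G) n : play_prefix (mkseq pi n.+2) =
    play_prefix (mkseq pi n.+1) && edge (pi n) (pi n.+1).
  by rewrite mkseq_rcons play_prefix_rcons// mkseq_rcons last_rcons.
apply/seteqP; split => pi /=.
  move=> [pi0 piE]; elim=> [|n IHn]; first by rewrite /play_prefix /= pi0 eqxx.
  by rewrite prefixE IHn piE.
move=> H; split => [|n].
  by have := H 0%N; rewrite /play_prefix /= andbT => /eqP[].
by have := H n.+1; rewrite prefixE => /andP[].
Qed.

Lemma measurable_is_play : measurable (@is_play k G : set (paths G)).
Proof.
rewrite is_playE (_ : [set _ | _] =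
  \bigcap_n [set pi : paths G | play_prefix (mkseq pi n.+1)]); last first.
  by apply/seteqP; split => [pi H n _|pi H n]; exact: H.
apply: bigcapT_measurable => n.
exact: (@measurable_prefix n.+1 [set h | play_prefix h]).
Qed.

Lemma measurable_MP (R : realType) j :
  measurable_fun setT ((fun pi => MP R pi j) : paths G -> \bar R).
Proof.
pose u (n : nat) (pi : paths G) : \bar R :=
  (n%:R^-1 * \sum_(i < n) (weight (pi i) (pi i.+1) 0 j)%:~R)%:E.
have mu n : measurable_fun setT (u n).
  pose F (h : seq G) : \bar R := (n%:R^-1 *
    \sum_(i < n) (weight (nth (init G) h i) (nth (init G) h i.+1) 0 j)%:~R)%:E.
  (* [n] transitions involve [n.+1] states. *)
  rewrite (_ : u n = fun pi => F (mkseq pi n.+1)); last first.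
    apply/funext => pi; rewrite /u /F; congr ((_ * _)%:E).
    apply: eq_bigr => i _; rewrite !nth_mkseq ?ltnS // ltnW//.
  exact: measurable_prefix_fun.
have -> : (fun pi : paths G => MP R pi j) =
    (fun pi => - limn_esup (fun n => - u n pi))%E.
  by apply/funext => pi; rewrite (limn_esupN (u^~ pi)) oppeK.
apply: measurableT_comp => //; apply: measurable_fun_limn_esup => n.
exact: measurableT_comp.
Qed.

Lemma measurable_MeanPayoff (R : realType) v :
  measurable (@MeanPayoff k G R v : set (paths G)).
Proof.
rewrite (_ : @MeanPayoff _ _ _ _ = @is_play k G `&`
    \bigcap_(j in [set: 'I_k]) [set pi | ((ratr (v 0 j))%:E <= MP R pi j)%E]).
  apply: measurableI; first exact: measurable_is_play.
  apply: fin_bigcap_measurable => // j _; rewrite -[X in measurable X]setTI.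
  by apply: measurable_lee => //; exact: measurable_MP.
by apply/seteqP; split => pi [H1 H2]; split => // j; [move=> _|]; exact: H2.
Qed.

End PrefixEvents.

(** The parity condition is a countable Boolean combination of the events [inf_often pi c], each of
    which is a limit superior of prefix events. *)
Lemma measurable_Parity k (G : parity_game k) :
  measurable (@Parity k G : set (paths G)).
Proof.
have mio c : measurable ([set pi | inf_often pi c] : set (paths G)).
  rewrite (_ : [set pi | _] = \bigcap_n \bigcup_(m in [set m | (n <= m)%N])
      [set pi : paths G | priority (last (init G) (mkseq pi m.+1)) = c]).
    apply: bigcapT_measurable => n; apply: bigcup_measurable => m _.
    exact: (@measurable_prefix _ G m.+1 [set h | priority (last (init G) h) = c]).
  have lastE (pi : nat -> G) m : last (init G) (mkseq pi m.+1) = pi m.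
    by rewrite mkseq_rcons last_rcons.
  apply/seteqP; split => [pi H n _|pi H n].
    by have [m nm pm] := H n; exists m => //; rewrite /mkset lastE.
  by have [//|m nm] := H n; rewrite /mkset lastE => pm; exists m.
rewrite (_ : @Parity _ _ = @is_play k G `&` \bigcup_(c in [set c | ~~ odd c])
    ([set pi | inf_often pi c] `&`
     \bigcap_d (~` [set pi | inf_often pi d] `|` [set _ | (c <= d)%N]))).
  apply: measurableI; first exact: measurable_is_play.
  apply: bigcup_measurable => c _; apply: measurableI => //.
  apply: bigcapT_measurable => d; apply: measurableU; first exact: measurableC.
  by case: (c <= d)%N; [rewrite set_true|rewrite set_false].
apply/seteqP; split => pi /= [pl [c]].
  move=> [oc ic H]; split => //; exists c => //; split => // d _ /=.
  by have [/H|] := pselect (inf_often pi d); [right|left].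
by move=> oc [ic H]; split=> //; exists c; split => // d id; have [] := H d I.
Qed.

(** * Averages and the Fredholm alternative *)

Section Averages.
Context {R : realType}.

Definition average (u : nat -> R) (n : nat) : R := n%:R^-1 * \sum_(i < n) u i.

Lemma cvg_bounded_div (u : nat -> R) (K : R) : (forall n, `|u n| <= K) ->
  (fun n => n%:R^-1 * u n) @ \oo --> (0 : R).
Proof.
move=> uK; apply/cvgrPdist_lt => e e0.
exists (Num.truncn (K / e)).+1 => // -[//|n] /= Kn.
rewrite sub0r normrN normrM ger0_norm// -ltr_pdivlMl ?invr_gt0// invrK.
apply: le_lt_trans (uK _) _; rewrite -ltr_pdivrMr//.
by apply: lt_le_trans (truncnS_gt _) _; rewrite ler_nat.
Qed.

(* The potential [c] telescopes, and finitely many terms do not matter. *)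
Lemma average_cvg (u v c : nat -> R) (m K : R) (T : nat) :
  (forall i, `|c i| <= K) ->
  (forall i, (T <= i)%N -> u i - m = v i + c i - c i.+1) ->
  average v @ \oo --> (0 : R) -> average u @ \oo --> m.
Proof.
move=> cK ucv v0.
pose D n := \sum_(i < n) (u i - m - v i) + c n.
have DT n : (T <= n)%N -> D n = D T.
  elim: n => [|n IHn]; first by rewrite leqn0 => /eqP ->.
  rewrite leq_eqVlt => /predU1P[-> //|]; rewrite ltnS => Tn.
  rewrite -(IHn Tn) /D big_ord_recr /= ucv//; ring.
have lim : (m + average v n + n%:R^-1 * (D T - c n)) @[n --> \oo] --> m + 0 + 0.
  apply: cvgD; first by apply: cvgD => //; exact: cvg_cst.
  apply: (@cvg_bounded_div _ (`|D T| + K)) => n.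
  by rewrite (le_trans (ler_normB _ _))// lerD2l.
rewrite !addr0 in lim; apply: cvg_trans lim; apply: near_eq_cvg.
exists T.+1 => // -[//|n] /= Tn.
rewrite -(DT n.+1) ?(ltnW Tn)// /D addrK sumrB sumrB sumr_const card_ord.
rewrite /average -mulr_natl; field.
by rewrite gt_eqF// addr_gt0.
Qed.

Lemma MP_average_cvg k (G : game k) (pi : nat -> G) j (m : R) :
  average (fun i => (weight (pi i) (pi i.+1) 0 j)%:~R) @ \oo --> m ->
  MP R pi j = m%:E.
Proof.
move=> cv; rewrite /MP.
have /cvg_limn_einf_sup[-> //] :
  (average (fun i => (weight (pi i) (pi i.+1) 0 j)%:~R) n)%:E @[n --> \oo] --> m%:E.
by apply/fine_cvgP; split; first exact: nearW.
Qed.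

End Averages.

(** A row vector lies in the row space of a matrix [A] as soon as [cokermx A] kills it, and each
    column of [cokermx A] is a vector [v] to which the hypothesis applies. *)
Lemma fredholm (F : fieldType) (T : finType) (a : T -> T -> F) (g : T -> F) :
  (forall v : T -> F, (forall t, \sum_s a t s * v s = 0) -> \sum_s g s * v s = 0) ->
  exists h : T -> F, forall s, \sum_t h t * a t s = g s.
Proof.
move=> H.
have sumE (f : T -> F) : \sum_t f t = \sum_(i < #|T|) f (enum_val i).
  rewrite [LHS](reindex_onto enum_val enum_rank) /=; last by move=> *; rewrite enum_rankK.
  by apply: eq_bigl => i; rewrite enum_valK eqxx.
pose A : 'M[F]_(#|T|) := \matrix_(i, j) a (enum_val i) (enum_val j).
pose b : 'rV[F]_(#|T|) := \row_j g (enum_val j).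
have /submxP[x xA] : (b <= A)%MS.
  rewrite submxE; apply/eqP/matrixP => i j; rewrite mxE [RHS]mxE.
  have /matrixP coker := mulmx_coker A.
  rewrite -[RHS](H (fun s => cokermx A (enum_rank s) j)).
    by rewrite sumE; apply: eq_bigr => l _; rewrite !mxE enum_valK.
  move=> t; have := coker (enum_rank t) j; rewrite !mxE => {2}<-.
  by rewrite sumE; apply: eq_bigr => l _; rewrite !mxE enum_valK enum_rankK.
exists (fun t => x 0 (enum_rank t)) => s.
have /matrixP/(_ 0 (enum_rank s)) := xA; rewrite !mxE enum_rankK => ->.
by rewrite sumE; apply: eq_bigr => l _; rewrite !mxE enum_valK enum_rankK.
Qed.

(** * A strong law of large numbers for plays *)

(* The term linear in the increment [d] is the one killed by the martingale
   property; the rest makes x^4 + 8 b^2 m x^2 + 4 b^4 m^2 bound the fourth moment of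
   x after m more steps. *)
Lemma quartic_step (R : realFieldType) (b m x d : R) :
  0 <= m -> d ^+ 2 <= b ^+ 2 ->
  (x + d) ^+ 4 + 8 * b ^+ 2 * m * (x + d) ^+ 2 + 4 * b ^+ 4 * m ^+ 2 <=
  x ^+ 4 + 8 * b ^+ 2 * (m + 1) * x ^+ 2 + 4 * b ^+ 4 * (m + 1) ^+ 2 +
  (4 * x ^+ 3 + 16 * b ^+ 2 * m * x) * d.
Proof.
move=> m0 db; have d0 := sqr_ge0 d; have x0 := sqr_ge0 x.
have b0 := le_trans d0 db.
have xd : x ^+ 2 * d ^+ 2 <= x ^+ 2 * b ^+ 2 by rewrite ler_wpM2l.
have dd : d ^+ 4 <= b ^+ 4 by have := ler_pM d0 d0 db db; lra.
(* The cubic term is absorbed into even ones by expanding d^2 (x - d)^2 >= 0. With the terms 6 x^2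
   d^2 and d^4 of the binomial this gives 8 x^2 d^2 + 3 d^4, whence the constants 8 and 4 of the
   potential. *)
have am : 4 * x * d ^+ 3 <= 2 * x ^+ 2 * d ^+ 2 + 2 * d ^+ 4.
  have := mulr_ge0 d0 (sqr_ge0 (x - d)); lra.
have nd : b ^+ 2 * m * d ^+ 2 <= b ^+ 2 * m * b ^+ 2.
  by rewrite ler_wpM2l// mulr_ge0.
have b4 : 0 <= b ^+ 4 by have := mulr_ge0 b0 b0; lra.
lra.
Qed.

Section PlayMeasureTheory.
Context {R : realType} {k : nat} {G : game k}.
Variables (l1 : strategy R G P1) (l2 : strategy R G P2).
Local Notation P := (play_measure l1 l2).
Local Notation q := (step l1 l2).

Let P_rcons h t : play_prefix h ->
  P (cylinder (rcons h t)) = (P (cylinder h) * (q h t)%:E)%E.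
Proof. by have [_] := play_measureP l1 l2; apply. Qed.

Let P_init : P (cylinder [:: init G]) = 1%E.
Proof. by have [] := play_measureP l1 l2. Qed.

Let mcyl (h : seq G) : measurable (cylinder h : set (paths G)).
Proof. exact: measurable_cylinder. Qed.

Let P_sub0 (A B : set (paths G)) : measurable A -> measurable B ->
  A `<=` B -> P B = 0%E -> P A = 0%E.
Proof. by move=> mA mB AB B0; apply: subset_measure0 AB B0. Qed.

Lemma step_ge0 h t : play_prefix h -> 0 <= q h t.
Proof. by move=> ph; have [] := step_distribution l1 l2 ph. Qed.

Lemma play_measure_null h : h != [::] -> ~~ play_prefix h -> P (cylinder h) = 0%E.
Proof.
elim/last_ind: h => // h t IHh _.
have [->|h0] := eqVneq h [::].
  rewrite /play_prefix /= andbT => ti.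
  apply: (@P_sub0 _ (~` cylinder [:: init G])) => //.
  - exact: measurableC.
  - move=> pi; rewrite /cylinder /mkseq /= => -[pi0] -[pi0'].
    by move: ti; rewrite -pi0 pi0' eqxx.
  - by rewrite probability_setC ?P_init ?subee.
rewrite play_prefix_rcons// negb_and; case: (boolP (play_prefix h)) => ph.
  move=> /= et; rewrite P_rcons//.
  by have [_ _ ->//] := step_distribution l1 l2 ph; rewrite mule0.
move=> _; apply: (@P_sub0 _ (cylinder h)) => //; first exact: sub_cylinder_rcons.
exact: IHh.
Qed.

(** The cylinders of measure zero are countably many, so their union is negligible. *)
Lemma ae_prefix_gt0 :
  {ae P, forall pi, forall n, (0 < P (cylinder (mkseq pi n)))%E}.
Proof.
pose F (i : nat) : set (paths G) := if unpickle i is Some h then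
  if P (cylinder h) == 0%E then cylinder h else set0 else set0.
apply: (@negligibleS _ _ _ _ (\bigcup_i F i)); last first.
  apply: negligible_bigcup => i; rewrite /F.
  case: unpickle => [h|]; last exact: negligible_set0.
  case: eqP => [h0|_]; last exact: negligible_set0.
  by apply/negligibleP.
move=> pi /= /existsNP[n /negP]; rewrite -leNgt => pn.
exists (pickle (mkseq pi n)) => //; rewrite /F pickleK.
by rewrite eq_le pn measure_ge0 /= /cylinder /= size_mkseq.
Qed.

Let ae_filter : Filter (almost_everywhere P).
Proof. exact: ae_filter_ringOfSetsType. Qed.

Lemma ae_is_play : {ae P, forall pi, is_play (pi : nat -> G)}.
Proof.
apply: (@filterS _ _ ae_filter _ _ _ ae_prefix_gt0) => pi pos; rewrite is_playE => n.
have := pos n.+1; apply: contraTT => /play_measure_null -> //.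
by rewrite ltxx.
Qed.

(** This reduces support arguments to single paths: whatever holds along every path whose steps all
    have positive probability holds almost surely. *)
Lemma ae_step_gt0 :
  {ae P, forall pi, forall n, 0 < q (mkseq pi n.+1) (pi n.+1)}.
Proof.
apply: (@filterS2 _ _ ae_filter _ _ _ _ ae_is_play ae_prefix_gt0) => pi.
rewrite is_playE /mkset => pp pos n.
rewrite lt_neqAle step_ge0 ?andbT//; apply/eqP => q0.
by have := pos n.+2; rewrite mkseq_rcons P_rcons// -q0 mule0 ltxx.
Qed.

(* A Markov inequality: [V n h] bounds the probability that the prefix [n] steps
   after [h] satisfies [Q]. *)
Lemma prefix_bound (V : nat -> seq G -> R) (Q : set (seq G)) :
  (forall n h, 0 <= V n h) -> (forall h, Q h -> 1 <= V 0%N h) ->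
  (forall n h, play_prefix h -> \sum_t q h t * V n (rcons h t) <= V n.+1 h) ->
  forall n, (P [set pi | Q (mkseq pi n.+1)] <= (V n [:: init G])%:E)%E.
Proof.
move=> V0 VQ Vsuper.
have mQ n : measurable ([set pi | Q (mkseq pi n)] : set (paths G)).
  exact: measurable_prefix.
(* The bound is localized to the cylinder of [h]; the induction on the number of remaining steps
   splits this cylinder by the next state. *)
have bound n h : play_prefix h ->
    (P (cylinder h `&` [set pi | Q (mkseq pi (size h + n))]) <=
     P (cylinder h) * (V n h)%:E)%E.
  elim: n h => [|n IHn] h ph.
    have [Qh|nQ] := pselect (Q h).
      apply: (@le_trans _ _ (P (cylinder h))).
        by apply: le_measure; rewrite ?inE//; exact: measurableI.
      by rewrite lee_pemulr// lee_fin VQ.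
    rewrite (_ : _ `&` _ = set0) ?measure0 ?mule_ge0 ?lee_fin//.
    by apply/seteqP; split => // pi []; rewrite /cylinder /= addn0 => ->.
  have step_bound t : (P (cylinder (rcons h t) `&`
      [set pi | Q (mkseq pi (size h + n.+1))]) <=
      P (cylinder h) * (q h t * V n (rcons h t))%:E)%E.
    have [pht|npht] := boolP (play_prefix (rcons h t)).
      have := IHn _ pht; rewrite size_rcons addSnnS => /le_trans; apply.
      by rewrite P_rcons// EFinM muleA.
    rewrite [X in (X <= _)%E](_ : _ = 0%E); last first.
      apply: (@P_sub0 _ (cylinder (rcons h t))) => //.
        exact: measurableI.
      by rewrite play_measure_null//; case: (h).
    by rewrite mule_ge0 // lee_fin mulr_ge0 ?step_ge0.
  pose F t : set (paths G) :=
    cylinder (rcons h t) `&` [set pi | Q (mkseq pi (size h + n.+1))].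
  have mF t : measurable (F t) by exact: measurableI.
  have [mU leU] : measurable (\big[setU/set0]_(t in G) F t) /\
      (P (\big[setU/set0]_(t in G) F t) <= \sum_(t in G) P (F t))%E.
    elim/big_rec2: _ => [|t x A _ [mA leA]]; first by rewrite measure0.
    split; first exact: measurableU.
    by rewrite (le_trans (measureU2 _ _ _))// leeD2l.
  apply: (@le_trans _ _ (P (\big[setU/set0]_(t in G) F t))).
    apply: le_measure; rewrite ?inE//; first exact: measurableI.
    move=> pi [hpi Qpi]; rewrite -bigcup_pred; exists (pi (size h)) => //.
    split => //; rewrite /cylinder /= size_rcons mkseq_rcons.
    by congr rcons.
  apply: le_trans leU _.
  apply: (@le_trans _ _ (\sum_(t in G) P (cylinder h) * (q h t * V n (rcons h t))%:E)%E).
    by apply: lee_sum => t _; exact: step_bound.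
  rewrite -ge0_sume_distrr; last by move=> t _; rewrite lee_fin mulr_ge0 ?step_ge0.
  by rewrite lee_wpmul2l// sumEFin lee_fin Vsuper.
move=> n; set Qn := [set pi | _].
have pi0 : play_prefix [:: init G] by rewrite /play_prefix /= eqxx.
have /= := bound n _ pi0; rewrite P_init mul1e add1n => {}bound.
(* The paths that do not start in the initial state are outside the cylinder, but form a null
   set. *)
apply: le_trans bound; rewrite -[leRHS]adde0.
have <- : P (~` cylinder [:: init G]) = 0%E.
  by rewrite probability_setC ?P_init ?subee.
apply: le_trans (measureU2 _ _ _) => //; last exact: measurableC.
  apply: le_measure; rewrite ?inE//; first exact: mQ.
    by apply: measurableU; [apply: measurableI => //; exact: mQ|exact: measurableC].
  move=> pi Qpi; have [ci|ci] := pselect (cylinder [:: init G] pi); [left|right] => //.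
by apply: measurableI => //; exact: mQ.
Qed.


(** * Fourth moments and the strong law for bounded martingale increments *)

Section StrongLaw.
Variable phi : G -> G -> R.

Definition prefix_sum (h : seq G) : R :=
  \sum_(i < (size h).-1) phi (nth (init G) h i) (nth (init G) h i.+1).

Lemma prefix_sum_mkseq (pi : nat -> G) n :
  prefix_sum (mkseq pi n.+1) = \sum_(i < n) phi (pi i) (pi i.+1).
Proof.
rewrite /prefix_sum size_mkseq; apply: eq_bigr => i _.
by rewrite !nth_mkseq ?ltnS// ltnW//.
Qed.

Lemma prefix_sum_rcons h t : h != [::] ->
  prefix_sum (rcons h t) = prefix_sum h + phi (last (init G) h) t.
Proof.
case/lastP: h => // h s _; rewrite /prefix_sum !size_rcons/= big_ord_recr /=.
congr (_ + _).
  apply: eq_bigr => i _; rewrite !(nth_rcons _ (rcons h s)) size_rcons !ltnS.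
  by rewrite (ltnW (ltn_ord i)) ltn_ord.
by rewrite nth_rcons size_rcons ltnSn nth_rcons ltnn eqxx nth_rcons size_rcons
  ltnn eqxx last_rcons.
Qed.

Hypothesis phi_mean0 : forall h, play_prefix h ->
  \sum_t q h t * phi (last (init G) h) t = 0.

Let b := 1 + \sum_s \sum_t `|phi s t|.

Let phi_le s t : phi s t ^+ 2 <= b ^+ 2.
Proof.
rewrite -real_normK ?num_real// lerXn2r ?nnegrE//.
  by rewrite addr_ge0// sumr_ge0// => *; rewrite sumr_ge0.
have le_sum (f : G -> R) x : (forall y, 0 <= f y) -> f x <= \sum_y f y.
  by move=> f0; rewrite (bigD1 x)//= lerDl sumr_ge0.
apply: (@le_trans _ _ (\sum_t `|phi s t|)); first exact: (le_sum (fun t => `|phi s t|)).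
apply: le_trans (le_sum (fun s => \sum_t `|phi s t|) s _) _.
  by move=> *; rewrite sumr_ge0.
by rewrite /b lerDr.
Qed.

Let pot (n : nat) (x : R) :=
  x ^+ 4 + 8 * b ^+ 2 * n%:R * x ^+ 2 + 4 * b ^+ 4 * n%:R ^+ 2.

(** Markov's inequality for the fourth power, through [prefix_bound]: in [pot], the first argument
    counts the steps still to go. The sum starts at 0, so that only the last term of [pot] survives
    in the bound. *)
Lemma prefix_sum_tail (a : R) n : 0 < a ->
  (P [set pi | (a <= `|prefix_sum (mkseq pi n.+1)|)%R] <=
   (4 * b ^+ 4 * n%:R ^+ 2 / a ^+ 4)%:E)%E.
Proof.
move=> a0.
have -> : 4 * b ^+ 4 * n%:R ^+ 2 / a ^+ 4 =
    pot n (prefix_sum [:: init G]) / a ^+ 4.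
  by rewrite /prefix_sum /= big_ord0 /pot !expr0n /= mulr0 !add0r.
have a4 : 0 < a ^+ 4 by exact: exprn_gt0.
have x4 (x : R) : 0 <= x ^+ 4 by rewrite -[4%N]/(2 * 2)%N exprM sqr_ge0.
have pot_ge0 m x : 0 <= pot m x.
  have sq (y : R) : 0 <= y ^+ 2 := sqr_ge0 y.
  rewrite /pot addr_ge0//; first by rewrite addr_ge0// mulr_ge0// mulr_ge0// mulr_ge0.
  by rewrite mulr_ge0// mulr_ge0.
apply: (@prefix_bound (fun m h => pot m (prefix_sum h) / a ^+ 4)
  [set h | a <= `|prefix_sum h|]).
- by move=> m h; rewrite divr_ge0// ltW.
- move=> h /= ah; rewrite ler_pdivlMr// mul1r /pot mulr0 mul0r expr0n /= mulr0 !addr0.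
  have -> : prefix_sum h ^+ 4 = `|prefix_sum h| ^+ 4.
    by rewrite -normrX ger0_norm.
  by apply: lerXn2r => //; rewrite nnegrE ltW.
- move=> m h ph; have h0 : h != [::] by case: (h) ph.
  under eq_bigr do rewrite mulrA.
  rewrite -mulr_suml ler_pM2r ?invr_gt0//.
  set x := prefix_sum h.
  have [_ q1 _] := step_distribution l1 l2 ph.
  apply: (@le_trans _ _ (\sum_t (q h t * pot m.+1 x +
    (4 * x ^+ 3 + 16 * b ^+ 2 * m%:R * x) * (q h t * phi (last (init G) h) t)))).
    apply: ler_sum => t _; rewrite mulrCA -mulrDr ler_wpM2l ?step_ge0//.
    by rewrite prefix_sum_rcons// /pot -[m.+1%:R]natr1; apply: quartic_step.
  by rewrite big_split /= -mulr_suml -mulr_sumr q1 phi_mean0// mulr0 addr0 mul1r.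
Qed.

Lemma strong_law : {ae P, forall pi : paths G,
  average (fun i => phi (pi i) (pi i.+1)) @ \oo --> (0 : R)}.
Proof.
(* The event that the average over the first [n.+1] steps is at least 1 / (m + 1) in absolute
   value. *)
pose F (m n : nat) : set (paths G) :=
  [set pi | n.+1%:R / m.+1%:R <= `|prefix_sum (mkseq pi n.+2)|].
have mF m n : measurable (F m n).
  exact: (@measurable_prefix _ _ n.+2 [set h | n.+1%:R / m.+1%:R <= `|prefix_sum h|]).
have small m : P (lim_sup_set (F m)) = 0%E.
  apply: lim_sup_set_cvg0 => //.
  (* The tail bound is 4 b^4 (m + 1)^4 / x^2 with x = n + 1. As 1 / x^2 <= 2 (1 / x - 1 / (x + 1))
     for x >= 1, doubling the constant dominates it by a telescoping series, and Borel-Cantelli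
     applies. *)
  pose C : R := 8 * b ^+ 4 * m.+1%:R ^+ 4.
  have C0 : 0 <= C.
    by rewrite /C -[4%N]/(2 * 2)%N !exprM mulr_ge0 ?sqr_ge0// mulr_ge0 ?sqr_ge0.
  have PF n : (P (F m n) <= (C / n.+1%:R - C / n.+2%:R)%:E)%E.
    apply: le_trans (prefix_sum_tail _ _) _; first by rewrite divr_gt0.
    rewrite lee_fin /C -[n.+2%:R]natr1.
    have x1 : 1 <= n.+1%:R :> R by rewrite ler1n.
    have y0 : 0 < m.+1%:R :> R by [].
    have b4 : 0 <= b ^+ 4 by rewrite -[4%N]/(2 * 2)%N exprM sqr_ge0.
    move: (n.+1%:R : R) (m.+1%:R : R) (b ^+ 4) x1 y0 b4 => x y d x1 y0 d0.
    have x0 : 0 < x by lra.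
    rewrite -subr_ge0 (_ : _ - _ = 4 * d * y ^+ 4 * (x - 1) / (x ^+ 2 * (x + 1))).
      by rewrite divr_ge0 ?mulr_ge0 ?exprn_ge0 ?subr_ge0 ?addr_ge0// ltW.
    by field; rewrite !gt_eqF//; lra.
  apply: (@le_lt_trans _ _ C%:E); last exact: ltry.
  apply: lime_le; first exact: is_cvg_nneseries.
  apply: nearW => n.
  apply: (@le_trans _ _ (\sum_(0 <= i < n) (C / i.+1%:R - C / i.+2%:R)%:E)%E).
    by apply: lee_sum => i _; exact: PF.
  rewrite sumEFin lee_fin (@telescope_sumr_eq _ _ _ (fun i => - (C / i.+1%:R)))//.
    by rewrite invr1 mulr1 opprK addrC lerBlDr lerDl divr_ge0.
  by move=> i _; rewrite opprK addrC.
have eventually_small m :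
    {ae P, forall pi, exists n0, forall n, (n0 <= n)%N -> ~ F m n pi}.
  exists (lim_sup_set (F m)); split => //.
    apply: bigcapT_measurable => n; apply: bigcup_measurable => *; exact: mF.
  move=> pi /= /forallNP H n _; have /existsNP[j] := H n.
  by move=> /not_implyP[nj /contrapT Fj]; exists j.
have /ae_foralln := eventually_small.
apply: (@filterS _ _ ae_filter) => pi H.
apply/cvgrPdist_lt => e e0.
(* This index [m] satisfies 1 / (m + 1) < e. *)
have [n0 Hn] := H (Num.truncn e^-1).
exists n0.+1 => // -[//|n] /= n0n; rewrite sub0r normrN normrM.
have /negP := Hn n n0n; rewrite -ltNge prefix_sum_mkseq => lt1.
rewrite ger0_norm// -ltr_pdivlMl ?invr_gt0// invrK.
apply: lt_le_trans lt1 _; rewrite ler_pM2l//.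
by rewrite -[leRHS]invrK lef_pV2 ?posrE// ?invr_gt0// ltW// truncnS_gt.
Qed.

End StrongLaw.

End PlayMeasureTheory.

(** * From almost sure statements to probabilities and expectations *)

Section AlmostSure.
Context {R : realType} {k : nat} {G : game k}.
Variable mu : probability (paths G) R.

Lemma ae_probability1 (A : set (paths G)) : measurable A ->
  {ae mu, forall pi, A pi} -> mu A = 1%E.
Proof.
move=> mA aeA; have /negligibleP : mu.-negligible (~` A) by exact: aeA.
move=> /(_ (measurableC mA)) A0.
have := probability_setC mu mA; rewrite A0 => /esym/eqP.
by rewrite sube_eq// ?fin_num_measure// add0e => /eqP.
Qed.

Lemma ae_integral_MP j (m : R) :
  {ae mu, forall pi, MP R (pi : nat -> G) j = m%:E} ->
  (\int[mu]_(pi in setT) MP R (pi : nat -> G) j = m%:E)%E.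
Proof.
move=> aeMP; rewrite (ae_eq_integral (cst m%:E))//.
- by rewrite integral_cst// [X in (_ * X)%E]probability_setT mule1.
- exact: measurable_MP.
- by apply: (@filterS _ _ (ae_filter_ringOfSetsType mu) _ _ _ aeMP) => pi.
Qed.

End AlmostSure.

(** * Memoryless strategies from ultimately periodic plays *)

Section Lasso.
Context {R : realType} {k : nat} {G : game k}.
Variables (pi : nat -> G) (T L : nat).
Hypothesis pi_play : is_play pi.
Hypothesis L_gt0 : (0 < L)%N.
Hypothesis pi_periodic : forall n, (T <= n)%N -> pi (n + L)%N = pi n.

(** Indexed by positions rather than states: a state may occur several times in one period, with
    different successors. *)
Let c (i : nat) : G := pi (T + i)%N.

Let c_wrap : c L = c 0%N.
Proof. by rewrite /c pi_periodic ?addn0. Qed.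

Let sum_shift (F : G -> R) : \sum_(i < L) F (c i.+1) = \sum_(i < L) F (c i).
Proof.
apply: (@addrI _ (F (c 0%N))); transitivity (\sum_(i < L.+1) F (c i)).
  by rewrite big_ord_recl.
by rewrite big_ord_recr /= c_wrap addrC.
Qed.

Let c_mod m : c (m %% L)%N = c m.
Proof.
rewrite [in RHS](divn_eq m L) /c; elim: (m %/ L)%N => [|a IHa].
  by rewrite mul0n add0n.
rewrite IHa -[LHS]pi_periodic ?leq_addr//; congr pi; lia.
Qed.

Let L_neq0 : L%:R != 0 :> R.
Proof. by rewrite pnatr_eq0 -lt0n. Qed.

Definition cycle_mean (f : G -> G -> R) : R :=
  L%:R^-1 * \sum_(i < L) f (c i) (c i.+1).

Definition on_cycle (s : G) : bool := [exists i : 'I_L, c i == s].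

Lemma on_cycleP s : reflect (exists n, (T <= n)%N /\ pi n = s) (on_cycle s).
Proof.
apply: (iffP existsP) => [[i /eqP <-]|[n [Tn <-]]].
  by exists (T + i)%N; rewrite leq_addr.
exists (Ordinal (ltn_pmod (n - T) L_gt0)); apply/eqP; rewrite /c /=.
by rewrite -/(c _) c_mod /c subnKC.
Qed.

(** The potential at time [i] is the sum of the centred payoffs over the current, incomplete period.
    It is bounded because it returns to 0 after each period. *)
Lemma pi_average (f : G -> G -> R) :
  average (fun i => f (pi i) (pi i.+1)) @ \oo --> cycle_mean f.
Proof.
set m := cycle_mean f.
pose S r := \sum_(j < r) (m - f (c j) (c j.+1)).
have SL : S L = 0.
  by rewrite /S sumrB sumr_const card_ord -mulr_natl /m /cycle_mean mulVKf ?subrr.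
apply: (@average_cvg _ _ (fun=> 0) (fun i => S ((i - T) %% L)%N) _
  (\sum_(j < L) `|m - f (c j) (c j.+1)|) T).
- move=> i; set r := (_ %% _)%N.
  have rL : (r <= L)%N by rewrite ltnW// ltn_pmod.
  apply: le_trans (ler_norm_sum _ _ _) _.
  rewrite (big_ord_widen _ (fun j => `|m - f (c j) (c j.+1)|) rL).
  by rewrite big_mkcond ler_sum// => j _; case: ifP.
- move=> i Ti; rewrite add0r subSn//.
  have cE : c ((i - T) %% L)%N = pi i /\ c ((i - T) %% L).+1 = pi i.+1.
    split; first by rewrite c_mod /c subnKC.
    by rewrite -c_mod -addn1 modnDml c_mod addn1 /c -subSn// subnKC// ltnW.
  (* At the last position of a period the index wraps to 0, and [SL] closes the telescoping. *)
  have [rL|rL] := ltnP ((i - T) %% L).+1 L; last first.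
    have rL' : ((i - T) %% L).+1 = L.
      by apply/eqP; rewrite eqn_leq rL ltn_pmod.
    rewrite -[(i - T).+1]addn1 -modnDml addn1 rL' modnn.
    have := SL; rewrite -{1}rL' /S big_ord_recr /= big_ord0 cE.1 cE.2 => SL'; lra.
  rewrite -[(i - T).+1]addn1 -modnDml addn1 (modn_small rL) {2}/S big_ord_recr /= -/(S _).
  by rewrite cE.1 cE.2; ring.
- rewrite (_ : average _ = fun=> 0); first exact: cvg_cst.
  by apply/funext => n; rewrite /average big1 ?mulr0.
Qed.

(** This is the Poisson equation of the chain that leaves a cycle state along each edge with its
    frequency, multiplied by the number of visits of [s] in a period; it thus needs no division and
    reads 0 = 0 off the cycle. It is solvable by [fredholm]: the vectors to be tested are constant
    on the cycle, and the centred payoffs sum to 0 over a period. *)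
Lemma poisson (f : G -> G -> R) : exists h : G -> R, forall s,
  \sum_(i < L) (c i == s)%:R *
    (f (c i) (c i.+1) - cycle_mean f + h (c i.+1) - h (c i)) = 0.
Proof.
set m := cycle_mean f.
(* The Laplacian of the cycle, acting on [h] through the index [t]. *)
pose a t s : R := \sum_(i < L) (c i == s)%:R * ((c i == t)%:R - (c i.+1 == t)%:R).
pose g s : R := \sum_(i < L) (c i == s)%:R * (f (c i) (c i.+1) - m).
have sum_ind (x : G) (F : G -> R) : \sum_t (x == t)%:R * F t = F x.
  rewrite (bigD1 x)//= eqxx mul1r big1 ?addr0// => t.
  by rewrite eq_sym => /negPf ->; rewrite mul0r.
have [v av|h hg] := @fredholm _ _ a g.
  (* A function v in the kernel is harmonic; its energy, the sum of the
     (v (c i) - v (c i.+1))^2, vanishes, so that v is constant on the cycle. *)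
  have cyc (F : nat -> G -> R) : \sum_s (\sum_(i < L) (c i == s)%:R * F i s) =
      \sum_(i < L) F i (c i).
    by rewrite exchange_big; apply: eq_bigr => i _; exact: sum_ind.
  have e0 : \sum_(i < L) v (c i) * (v (c i) - v (c i.+1)) = 0.
    transitivity (\sum_t v t * \sum_s a t s * v s); last first.
      by rewrite big1// => t _; rewrite av mulr0.
    transitivity (\sum_t v t *
        \sum_(i < L) ((c i == t)%:R - (c i.+1 == t)%:R) * v (c i)); last first.
      apply: eq_bigr => t _; congr (_ * _).
      rewrite -(cyc (fun i s => ((c i == t)%:R - (c i.+1 == t)%:R) * v s)).
      apply: eq_bigr => s _; rewrite mulr_suml; apply: eq_bigr => i _.
      by rewrite mulrA.
    under [RHS]eq_bigr do rewrite mulr_sumr.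
    rewrite exchange_big; apply: eq_bigr => i _ /=.
    rewrite -{2}(sum_ind (c i) v) -(sum_ind (c i.+1) v) -sumrB mulr_sumr.
    by apply: eq_bigr => t _; ring.
  have vc i : (i < L)%N -> v (c i) = v (c i.+1).
    (* The squares of [v (c i)] and of [v (c i.+1)] have the same sum over a period, so the energy
       is twice the sum in [e0]. *)
    have : \sum_(i < L) (v (c i) - v (c i.+1)) ^+ 2 = 0.
      transitivity (2 * \sum_(i < L) v (c i) * (v (c i) - v (c i.+1)) +
        (\sum_(i < L) v (c i.+1) ^+ 2 - \sum_(i < L) v (c i) ^+ 2)).
        rewrite mulr_sumr -sumrB -big_split; apply: eq_bigr => j _ /=; ring.
      by rewrite e0 (sum_shift (fun s => v s ^+ 2)) subrr mulr0 addr0.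
    move=> /eqP; rewrite psumr_eq0; last by move=> j _; exact: sqr_ge0.
    move=> /allP v0 iL; have := v0 (Ordinal iL); rewrite mem_index_enum.
    by move=> /(_ isT) /=; rewrite sqrf_eq0 subr_eq0 => /eqP.
  have v0 i : (i <= L)%N -> v (c i) = v (c 0%N).
    by elim: i => // i IHi iL; rewrite -vc// IHi// ltnW.
  under eq_bigr do rewrite mulr_suml.
  rewrite (eq_bigr (fun s => \sum_(i < L) (c i == s)%:R *
    ((f (c i) (c i.+1) - m) * v s))); last first.
    by move=> s _; apply: eq_bigr => i _; rewrite mulrA.
  rewrite (cyc (fun i s => (f (c i) (c i.+1) - m) * v s)).
  rewrite (eq_bigr (fun i : 'I_L => (f (c i) (c i.+1) - m) * v (c 0%N))); last first.
    by move=> i _; rewrite v0// ltnW.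
  rewrite -mulr_suml sumrB sumr_const card_ord -mulr_natl.
  by rewrite /m /cycle_mean mulVKf// subrr mul0r.
exists h => s; have := hg s; rewrite /a /g => hgs.
under eq_bigr do rewrite -addrA mulrDr.
rewrite big_split /= -hgs (_ : \sum_t _ =
    \sum_(i < L) (c i == s)%:R * (h (c i) - h (c i.+1))).
  by rewrite -big_split big1//= => i _; ring.
under eq_bigr do rewrite mulr_sumr.
rewrite exchange_big; apply: eq_bigr => i _ /=.
rewrite -(sum_ind (c i) h) -(sum_ind (c i.+1) h) -sumrB mulr_sumr.
by apply: eq_bigr => t _; ring.
Qed.


(* The [xchoose] case concerns states that are not visited before time [T]. *)
Definition last_exit (s : G) : G :=
  if [pick i : 'I_T | pi i == s] is Some i0
  then pi [arg max_(i > i0 | pi i == s) i]%N.+1 else xchoose (edge_total s).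

Definition lasso_kernel (s t : G) : R :=
  if on_cycle s then (\sum_(i < L) (c i == s)%:R)^-1 *
    \sum_(i < L) (c i == s)%:R * (c i.+1 == t)%:R
  else (t == last_exit s)%:R.

Let visits_gt0 s : on_cycle s -> 0 < \sum_(i < L) (c i == s)%:R :> R.
Proof.
case/existsP => i ci; rewrite (bigD1 i)//= ci ltr_pwDl//.
by rewrite sumr_ge0.
Qed.

Lemma lasso_kernel_sum s (F : G -> R) : on_cycle s ->
  \sum_t lasso_kernel s t * F t =
  (\sum_(i < L) (c i == s)%:R)^-1 * \sum_(i < L) (c i == s)%:R * F (c i.+1).
Proof.
move=> sC; rewrite /lasso_kernel sC.
under eq_bigr do rewrite -mulrA mulr_suml.
rewrite -mulr_sumr exchange_big; congr (_ * _); apply: eq_bigr => i _ /=.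
under eq_bigr do rewrite -mulrA.
rewrite -mulr_sumr (bigD1 (c i.+1))//= eqxx mul1r big1 ?addr0// => t.
by rewrite eq_sym => /negPf ->; rewrite mul0r.
Qed.

Let edge_last_exit s : edge s (last_exit s).
Proof.
rewrite /last_exit; case: pickP => [i0 pi0|_]; last exact: xchooseP.
case: arg_maxnP => // i /eqP <- _; exact: (pi_play.2).
Qed.

Lemma lasso_kernel_distribution s : distribution_on (edge s) (lasso_kernel s).
Proof.
split=> [t||t nst].
- rewrite /lasso_kernel; case: ifP => // _; apply: mulr_ge0.
    by rewrite invr_ge0 sumr_ge0.
  by apply: sumr_ge0 => i _; exact: mulr_ge0.
- have [sC|sC] := boolP (on_cycle s).
    under eq_bigr do rewrite -[lasso_kernel _ _]mulr1.
    rewrite (lasso_kernel_sum (fun=> 1))//.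
    under [X in _ * X]eq_bigr do rewrite mulr1.
    by rewrite mulVf// gt_eqF// visits_gt0.
  rewrite /lasso_kernel (negPf sC) (bigD1 (last_exit s))//= eqxx big1 ?addr0// => t.
  by move=> /negPf ->.
- rewrite /lasso_kernel; case: ifP => [_|_].
    rewrite [X in _ * X]big1 ?mulr0// => i _.
    case: eqP => [cs|]; last by rewrite mul0r.
    case: eqP => [ct|]; last by rewrite mulr0.
    by move: nst; rewrite -cs -ct /c addnS (pi_play.2).
  by case: eqP nst => // ->; rewrite edge_last_exit.
Qed.

Let cycle_step s t : on_cycle s -> 0 < lasso_kernel s t -> on_cycle t.
Proof.
rewrite /lasso_kernel => ->; apply: contraTT => nC.
rewrite [X in _ * X]big1 ?mulr0 ?ltxx// => i _.
case: eqP => _; last by rewrite mul0r.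
case: eqP => [ci|]; last by rewrite mulr0.
move: nC; rewrite -ci => /on_cycleP[]; exists (T + i.+1)%N.
by rewrite leq_addr.
Qed.

(* The last visit of a transient state by [pi] moves forward along [x]. *)
Lemma lasso_trap (x : nat -> G) : x 0%N = pi 0%N ->
  (forall n, 0 < lasso_kernel (x n) (x n.+1)) ->
  forall n, (T <= n)%N -> on_cycle (x n).
Proof.
move=> x0 xK.
(* While [x] is outside the cycle, each step raises the latest time at which [pi] visits its current
   state; this time stays below [T]. *)
have H n : on_cycle (x n) \/ exists j, [/\ (n <= j)%N, (j < T)%N & pi j = x n].
  elim: n => [|n [xC|[j [nj jT xj]]]].
  - case: (posnP T) => T0; [left|right].
      by apply/on_cycleP; exists 0%N; rewrite T0.
    by exists 0%N.
  - by left; exact: cycle_step (xK n).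
  - have [xC|xC] := boolP (on_cycle (x n)).
      by left; exact: cycle_step (xK n).
    have := xK n; rewrite /lasso_kernel (negPf xC).
    case: eqP => [-> _|]; last by rewrite ltxx.
    rewrite /last_exit; case: pickP => [i0 pi0|/(_ (Ordinal jT))]; last first.
      by rewrite /= xj eqxx.
    case: arg_maxnP => // i pii /(_ (Ordinal jT)) /=; rewrite xj eqxx => /(_ isT) ji.
    have [iT|iT] := ltnP i.+1 T; [right|left].
      by exists i.+1; split => //; rewrite ltnS (leq_trans nj).
    by apply/on_cycleP; exists i.+1.
move=> n Tn; have [//|[j [nj jT _]]] := H n.
by move: (leq_trans Tn nj); rewrite leqNgt jT.
Qed.

(** * Almost sure behaviour of the memoryless strategy *)

Section LassoStrategy.
Variables (l1 : strategy R G P1) (l2 : strategy R G P2).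
Hypothesis l1_kernel : forall h, play_prefix h ->
  step l1 l2 h = lasso_kernel (last (init G) h).
Local Notation P := (play_measure l1 l2).

Let ae_filter : Filter (almost_everywhere P).
Proof. exact: ae_filter_ringOfSetsType. Qed.

Lemma ae_lasso_trap :
  {ae P, forall x : paths G, forall n, (T <= n)%N -> on_cycle (x n)}.
Proof.
apply: (@filterS2 _ _ ae_filter _ _ _ _ (ae_is_play l1 l2) (ae_step_gt0 l1 l2)).
move=> x xp xq; apply: lasso_trap => [|n]; first by rewrite xp.1 pi_play.1.
have := xq n; rewrite l1_kernel; last by move: xp; rewrite is_playE; apply.
by rewrite mkseq_rcons last_rcons.
Qed.

Lemma ae_lasso_average (f : G -> G -> R) :
  {ae P, forall x : paths G,
    average (fun i => f (x i) (x i.+1)) @ \oo --> cycle_mean f}.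
Proof.
have [h hP] := poisson f; set m := cycle_mean f in hP *.
(* The Poisson equation only controls the cycle. Off it the increment is set to 0, which keeps the
   mean zero and changes only steps before time [T]. *)
pose phi s t := if on_cycle s then f s t - m + h t - h s else 0.
have phi0 hh : play_prefix hh ->
    \sum_t step l1 l2 hh t * phi (last (init G) hh) t = 0.
  move=> /l1_kernel ->; set s := last _ _; rewrite /phi.
  have [sC|_] := boolP (on_cycle s); last by rewrite big1// => t _; rewrite mulr0.
  rewrite (lasso_kernel_sum (fun t => f s t - m + h t - h s))//.
  rewrite [X in _ * X](_ : _ = 0) ?mulr0// -[RHS](hP s).
  by apply: eq_bigr => i _; case: eqP => [->//|_]; rewrite !mul0r.
have slln := strong_law phi0.
apply: (@filterS2 _ _ ae_filter _ _ _ _ ae_lasso_trap slln).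
move=> x xC; apply: (@average_cvg _ _ (fun i => phi (x i) (x i.+1))
  (fun i => h (x i)) m (\sum_s `|h s|) T) => //.
- move=> i; rewrite (bigD1 (x i))//= lerDl sumr_ge0//.
- by move=> i Ti; rewrite /phi xC//; ring.
Qed.

(** The frequency of visits to [s] converges to its positive frequency in the cycle, whereas
    finitely many visits would make it tend to 0. *)
Lemma ae_lasso_visits s : on_cycle s ->
  {ae P, forall x : paths G, forall n, exists m, (n <= m)%N /\ x m = s}.
Proof.
move=> sC.
apply: (@filterS _ _ ae_filter _ _ _ (ae_lasso_average (fun s' _ => (s' == s)%:R))).
move=> x cv n; apply/not_existsP => nx.
suff cv0 : average (fun i => (x i == s)%:R) @ \oo --> (0 : R).
  have : cycle_mean (fun s' _ => (s' == s)%:R) == 0.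
    by rewrite -(cvg_lim _ cv)// (cvg_lim _ cv0).
  by rewrite /cycle_mean mulf_eq0 invr_eq0 (negPf L_neq0) (gt_eqF (visits_gt0 sC)).
apply: (@average_cvg _ _ (fun=> 0) (fun=> 0) _ 0 n) => //.
- by move=> i; rewrite normr0.
- move=> i ni; rewrite !subr0 addr0; case: eqP => // xi; case: (nx i); split => //.
- rewrite (_ : average _ = fun=> 0); first exact: cvg_cst.
  by apply/funext => j; rewrite /average big1 ?mulr0.
Qed.

End LassoStrategy.
End Lasso.

(** * The single play of a Moore machine in a one-player game *)

Lemma iter_eventually_periodic (X : finType) (f : X -> X) x :
  exists T L, (0 < L)%N /\ forall n, (T <= n)%N -> iter (n + L) f x = iter n f x.
Proof.
(* Pigeonhole: the first [#|X|.+1] iterates cannot be distinct. *)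
have /injectivePn[i [j ij fij]] :
    ~~ injectiveb (fun i : 'I_#|X|.+1 => iter i f x).
  by apply/negP => /injectiveP /leq_card; rewrite card_ord ltnn.
wlog lt_ij : i j ij fij / (i < j)%N => [H|].
  have [|ji|/val_inj e] := ltngtP i j; first exact: H.
    by apply: (H j i) => //; rewrite eq_sym.
  by rewrite e eqxx in ij.
exists i, (j - i)%N; rewrite subn_gt0; split=> // n iN.
by rewrite -(subnK iN) -addnA subnKC ?(ltnW lt_ij)// !iterD fij.
Qed.

Section MoorePlay.
Context {R : realType} {k : nat} {G : game k}.
Variable M : moore_machine G.

Definition moore_step (x : memory M * G) : memory M * G :=
  (memory_update x.1 x.2, next_action x.1 x.2).

Definition moore_play (n : nat) : G :=
  (iter n moore_step (memory_init M, init G)).2.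

(** Every state belongs to player 1, so the only step of positive probability is the action of the
    machine, and [ae_step_gt0] leaves one path. *)
Lemma ae_moore_play (l1 : strategy R G P1) (l2 : strategy R G P2) :
  one_player G -> encodes M l1 ->
  {ae play_measure l1 l2, forall x : paths G, x = moore_play}.
Proof.
move=> G1 enc.
apply: (@filterS2 _ _ (ae_filter_ringOfSetsType (play_measure l1 l2)) _ _ _ _
  (ae_is_play l1 l2) (ae_step_gt0 l1 l2)) => x xp xq.
suff H n : iter n moore_step (memory_init M, init G) =
    (foldl (@memory_update _ _ M) (memory_init M) (mkseq x n), x n).
  by apply/funext => n; rewrite /moore_play H.
elim: n => [|n IHn]; first by rewrite /= xp.1.
rewrite iterS IHn mkseq_rcons foldl_rcons /moore_step; congr (_, _).
have := xq n; rewrite /step mkseq_rcons last_rcons G1 enc//; last first.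
  by rewrite -mkseq_rcons; move: xp; rewrite is_playE; apply.
by case: eqP => [->//|_]; rewrite ltxx.
Qed.

(** An almost sure event is nonempty: some path is both a play and equal to [moore_play]. *)
Lemma moore_play_is_play (l1 : strategy R G P1) (l2 : strategy R G P2) :
  one_player G -> encodes M l1 -> is_play moore_play.
Proof.
move=> G1 enc; set P := play_measure l1 l2.
have PF : ProperFilter (almost_everywhere P).
  apply: ae_properfilter_algebraOfSetsType.
  by have /= -> : P setT = 1%E := probability_setT P.
have [x [xp <- //]] := @filter_ex _ _ PF _
  (@filterI _ _ PF _ _ (ae_is_play l1 l2) (ae_moore_play l2 G1 enc)).
Qed.

End MoorePlay.

(** * Transfer of both guarantees to the memoryless strategy *)

Lemma inf_often_cycle k (G : parity_game k) (pi : nat -> G) (T L : nat) (x : nat -> G) :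
  (0 < L)%N -> (forall n, (T <= n)%N -> pi (n + L)%N = pi n) ->
  (forall n, (T <= n)%N -> on_cycle pi T L (x n)) ->
  (forall i n, exists m, (n <= m)%N /\ x m = pi (T + i)%N) ->
  forall d, inf_often x d <-> inf_often pi d.
Proof.
move=> L0 per xC xV d; split => xd n.
  have [m Tm <-] := xd T; have /(on_cycleP L0 per)[i [Ti <-]] := xC m Tm.
  exists (i + n * L)%N; first by rewrite (leq_trans (leq_pmulr n L0)) ?leq_addl.
  elim: n => [|n IHn]; first by rewrite mul0n addn0.
  by rewrite mulSn addnCA addnC per// (leq_trans Ti) ?leq_addr.
have [i Ti <-] := xd T; have [m [nm xm]] := xV (i - T)%N n.
by exists m => //; rewrite xm subnKC.
Qed.

(** Under the pure strategy the objective has probability 1 or 0, according to whether the play [pi]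
    meets it. In the first case the memoryless strategy also meets it almost surely; in the second,
    [alpha] is at most 0. The mean payoffs of both strategies are almost surely those of the
    cycle. *)
Lemma one_player_memoryless (R : realType) (k : nat) (G : parity_game k)
  (v : 'rV[rat]_k) (alpha : R) (beta : 'rV[rat]_k) (l1 : strategy R G P1) :
  one_player G -> alpha <= 1 -> pure_finite_memory l1 ->
  satisfaction l1 alpha (@MeanPayoff k G R v `&` @Parity k G) ->
  expectation_MP l1 beta ->
  exists l1' : strategy R G P1,
    [/\ memoryless l1',
        satisfaction l1' alpha (@MeanPayoff k G R v `&` @Parity k G)
      & expectation_MP l1' beta].
Proof.
move=> G1 a1 [M enc] sat expe; set phi := _ `&` _ in sat *.
have mphi : measurable (phi : set (paths G)).
  by apply: measurableI; [exact: measurable_MeanPayoff|exact: measurable_Parity].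
have [T [L [L0 per]]] :=
  iter_eventually_periodic (@moore_step _ _ M) (memory_init M, init G).
pose pi := @moore_play _ _ M.
have {}per n : (T <= n)%N -> pi (n + L)%N = pi n.
  by move=> /per; rewrite /pi /moore_play => ->.
(* Player 2 owns no state, so any function is a strategy; this one provides a play measure. *)
have l20 : strategy R G P2.
  by apply: (@Strategy _ _ _ _ (fun _ _ => 0)) => h s _; rewrite G1.
have pi_play : is_play pi by exact: (moore_play_is_play l20 G1 enc).
pose K := lasso_kernel (R := R) pi T L.
have kP h s : play_prefix (rcons h s) -> owner s = P1 ->
    distribution_on (edge s) (K (last (init G) (rcons h s))).
  by move=> _ _; rewrite last_rcons; exact: lasso_kernel_distribution.
pose l1' := @Strategy _ R G P1 (fun h => K (last (init G) h)) kP.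
have l1K l2 h : play_prefix h -> step l1' l2 h = K (last (init G) h).
  by move=> _; rewrite /step G1.
pose m j : R := cycle_mean pi T L (fun s t => (weight s t 0 j)%:~R).
have MPpi j : MP R pi j = (m j)%:E.
  apply: MP_average_cvg.
  exact: (pi_average L0 per (f := fun s t => (weight s t 0 j)%:~R)).
have ae_MP l2 : {ae play_measure l1' l2,
    forall x, forall j, MP R (x : nat -> G) j = (m j)%:E}.
  have FF := ae_filter_ringOfSetsType (play_measure l1' l2).
  apply: (@filter_forall _ _ _ _ FF) => j.
  have := ae_lasso_average pi_play L0 per (l1K l2) (fun s t => (weight s t 0 j)%:~R).
  by apply: (@filterS _ _ FF) => x; exact: MP_average_cvg.
exists l1'; split.
- by move=> h h' s _ _ _; rewrite /= !last_rcons.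
- move=> l2; have FF := ae_filter_ringOfSetsType (play_measure l1' l2).
  have [phi_pi|nphi] := pselect (phi pi).
    rewrite ae_probability1 ?lee_fin//.
    have visits : {ae play_measure l1' l2, forall x : paths G, forall i n,
        exists j, (n <= j)%N /\ x j = pi (T + i)%N}.
      apply: ae_foralln => i; apply: ae_lasso_visits (l1K l2) _ _ => //.
      by apply/(on_cycleP L0 per); exists (T + i)%N; rewrite leq_addr.
    have := @filterI _ _ FF _ _ (ae_MP l2)
      (@filterI _ _ FF _ _ (ae_is_play l1' l2)
      (@filterI _ _ FF _ _ (ae_lasso_trap pi_play L0 per (l1K l2)) visits)).
    apply: (@filterS _ _ FF) => x [xMP [xp [xC xV]]].
    have io := inf_often_cycle L0 per xC xV.
    case: phi_pi => -[_ piMP] [_ [d [od dinf dmin]]].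
    split; split => //.
      by move=> j; rewrite xMP -MPpi.
    exists d; split => //; first exact/io.
    by move=> e /io/dmin.
  apply: (@le_trans _ _ 0%E) => //.
  apply: (le_trans (sat l2)); rewrite le_eqVlt; apply/orP; left; apply/eqP.
  apply: measure_negligible => //.
  have := ae_moore_play l2 G1 enc; apply: negligibleS => x phix /= xpi.
  by apply: nphi; rewrite /pi -xpi.
- move=> l2 j; rewrite (@ae_integral_MP _ _ _ _ j (m j)); last first.
    have FF := ae_filter_ringOfSetsType (play_measure l1' l2).
    by apply: (@filterS _ _ FF _ _ _ (ae_MP l2)) => x.
  have := expe l2 j; rewrite (@ae_integral_MP _ _ _ _ j (m j))//.
  have FF := ae_filter_ringOfSetsType (play_measure l1 l2).
  by apply: (@filterS _ _ FF _ _ _ (ae_moore_play l2 G1 enc)) => x ->.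
Qed.

(** * A two-player game that requires memory *)

Section MooreStrategy.
Context {R : realType} {k : nat} {G : game k} (i : player) (M : moore_machine G).
Hypothesis next_edge : forall m s, owner s = i -> edge s (next_action (m : memory M) s).

Lemma moore_strategy_exists : exists l : strategy R G i, encodes M l.
Proof.
(* The last state is dropped because the memory has only read the states already left. *)
pose d (h : seq G) (t : G) : R := (t == next_action (foldl (@memory_update _ _ M)
  (memory_init M) (take (size h).-1 h)) (last (init G) h))%:R.
have dE h s t : d (rcons h s) t =
    (t == next_action (foldl (@memory_update _ _ M) (memory_init M) h) s)%:R.
  by rewrite /d size_rcons last_rcons -cats1 take_size_cat.
have dP h s : play_prefix (rcons h s) -> owner s = i ->
    distribution_on (edge s) (d (rcons h s)).
  move=> _ si; split=> [t||t]; rewrite ?dE//.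
    rewrite (bigD1 (next_action (foldl (@memory_update _ _ M) (memory_init M) h) s))//=.
    by rewrite dE eqxx big1 ?addr0// => t /negPf tn; rewrite dE tn.
  by case: eqP => // ->; rewrite next_edge.
by exists (Strategy dP) => h s _ _ t; rewrite /= dE.
Qed.

End MooreStrategy.

Section MatchingGame.

(* In the state [(i, None)] player 1 (if [i]) or player 2 chooses a bit; the state
   [(i, Some b)] records that the choice was [b], and leads to the other player. *)
Definition matching_owner (s : bool * option bool) : player :=
  if s.1 then P1 else P2.

Definition matching_edge : rel (bool * option bool) := fun s t =>
  match s.2, t.2 with
  | None, Some _ => s.1 == t.1
  | Some _, None => s.1 != t.1
  | _, _ => false
  end.

Definition matching_next (m : bool) (s : bool * option bool) : bool * option bool :=
  match s.2 with None => (s.1, Some m) | Some _ => (~~ s.1, None) end.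

Lemma matching_next_edge (m : bool) s : matching_edge s (matching_next m s).
Proof. by case: s => [[] []]. Qed.

(** The bit [false] pays (1, -1) and [true] pays (-1, 1), on the edge entering the state that
    records it, whichever player chooses. *)
Definition matching_weight (_ t : bool * option bool) : 'rV[int]_2 :=
  if t.2 is Some b then \row_(j < 2) (-1) ^+ (b + j)%N else 0.

Lemma matching_edge_total s : exists t, matching_edge s t.
Proof. by exists (matching_next true s); exact: matching_next_edge. Qed.

Definition matching_game : game 2 :=
  @Game 2 (bool * option bool)%type matching_owner (false, None) matching_edge
    matching_edge_total matching_weight.

Definition matching_memory (m : bool) (s : bool * option bool) : bool :=
  if s is (false, Some b) then b else m.

Definition matching_machine : moore_machine matching_game :=
  @MooreMachine 2 matching_game bool true matching_memory
    (fun m s => matching_next (~~ m) s).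

Context {R : realType}.

Lemma matching_expectation0 (l1 : strategy R matching_game P1) :
  encodes matching_machine l1 -> expectation_MP l1 0.
Proof.
move=> enc l2 j; set P := play_measure l1 l2.
have FF := ae_filter_ringOfSetsType P.
rewrite mxE rmorph0 (@ae_integral_MP _ _ _ _ j 0)//.
apply: (@filterS2 _ _ FF _ _ _ _ (ae_is_play l1 l2) (ae_step_gt0 l1 l2)) => x xp xq.
pose mem n := foldl matching_memory true (mkseq x n).
pose pot (m : bool) (s : bool * option bool) : R :=
  match s with
  | (false, Some b) => - (-1) ^+ (b + j)%N
  | (true, None) => - (-1) ^+ (m + j)%N
  | _ => 0
  end.
(* [pot] is minus the payoff accumulated in the current round. *)
have pot_step i : (weight (x i) (x i.+1) 0 j)%:~R =
    pot (mem i) (x i) - pot (mem i.+1) (x i.+1).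
  have memS : mem i.+1 = matching_memory (mem i) (x i).
    by rewrite /mem mkseq_rcons foldl_rcons.
  have := xp.2 i.
  have : owner (x i) = P1 -> x i.+1 = matching_next (~~ mem i) (x i).
    move=> oi; have := xq i; rewrite mkseq_rcons /step last_rcons oi enc//; last first.
      by rewrite -mkseq_rcons; move: xp; rewrite is_playE; apply.
    by case: eqP => // _; rewrite ltxx.
  rewrite memS; case: (x i) (x i.+1) => [[] [b|]] [[] [b'|]] //= own _;
    rewrite /matching_weight /= ?mxE ?subrr ?rmorph0// ?rmorphXn ?rmorphN1.
    by have [->] := own erefl; rewrite !exprD; case: (mem i) => /=; ring.
  by rewrite sub0r opprK.
apply: MP_average_cvg.
apply: (@average_cvg _ _ (fun=> 0) (fun i => pot (mem i) (x i)) 0 1 0).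
- move=> i; rewrite /pot; case: (x i) => [[] [b|]]; rewrite ?normr0//.
    by rewrite normrN normrX normrN1 expr1n.
  by rewrite normrN normrX normrN1 expr1n.
- by move=> i _; rewrite pot_step; ring.
- rewrite (_ : average _ = fun=> 0); first exact: cvg_cst.
  by apply/funext => n; rewrite /average big1 ?mulr0.
Qed.

Definition matching_constant (b : bool) : strategy R matching_game P2.
Proof.
apply: (@Strategy _ R matching_game P2
  (fun h t => (t == matching_next b (last (false, None) h))%:R)) => h s _ _.
split=> [t||t] //.
  rewrite (bigD1 (matching_next b s))//= last_rcons eqxx big1 ?addr0// => t.
  by move=> /negPf ->.
rewrite last_rcons; case: eqP => // -> /negP[]; exact: matching_next_edge.
Defined.

(** Against the constant bit [b], the expected payoff of a round in dimension [j] is that of [b]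
    plus that of the fixed random choice of player 1; [p] is the law of this choice. *)
Lemma matching_memoryless_value (l1 : strategy R matching_game P1) :
  memoryless l1 -> expectation_MP l1 0 ->
  exists p : bool -> R, [/\ forall b, 0 <= p b, p true + p false = 1 &
    forall (b : bool) (j : 'I_2), 0 <= (-1) ^+ (b + j)%N +
      (p true * (-1) ^+ (true + j)%N + p false * (-1) ^+ (false + j)%N)].
Proof.
move=> mless exp0.
(* By memorylessness, this play prefix stands for all those leading to [(true, None)]. *)
pose h0 : seq matching_game := [:: (false, None); (false, Some false)].
have ph0 : play_prefix (rcons h0 (true, None)) by [].
have [p_ge0 p_sum p_edge] := strategyP l1 ph0 erefl.
pose p b := l1 (rcons h0 (true, None)) (true, Some b).
have sumE (F : bool * option bool -> R) :
    \sum_t l1 (rcons h0 (true, None)) t * F t =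
    p true * F (true, Some true) + p false * F (true, Some false).
  rewrite (bigD1 (true, Some true))//= (bigD1 (true, Some false))//= addrA.
  rewrite big1 ?addr0// => -[[] [[]|]]//= _; rewrite p_edge ?mul0r//.
have p1 : p true + p false = 1.
  rewrite -p_sum; under [RHS]eq_bigr do rewrite -[l1 _ _]mulr1.
  by rewrite (sumE (fun=> 1)) !mulr1.
exists p; split=> // [b|b j]; first exact: p_ge0.
set tau := p true * _ + _; set sigma := (-1) ^+ _.
pose l2 := matching_constant b; set P := play_measure l1 l2.
have FF := ae_filter_ringOfSetsType P.
(* A round has 4 steps; [pot] solves the Poisson equation. *)
pose m := (sigma + tau) / 4.
pose f s t : R := (matching_weight s t 0 j)%:~R.
pose pot (s : bool * option bool) : R :=
  match s with
  | (false, None) => 0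
  | (false, Some _) => tau - 3 * m
  | (true, None) => tau - 2 * m
  | (true, Some _) => - m
  end.
pose phi (s t : matching_game) : R := f s t - m + pot t - pot s.
have fE s b' b'' : f s (b', Some b'') = (-1) ^+ (b'' + j)%N.
  by rewrite /f /matching_weight /= mxE rmorphXn rmorphN1.
have fN s b' : f s (b', None) = 0 by rewrite /f /matching_weight /= mxE.
have phi0 h : play_prefix h ->
    \sum_t step l1 l2 h t * phi (last (init matching_game) h) t = 0.
  case/lastP: h => // h s ph; rewrite /step last_rcons.
  have det (t0 : matching_game) (F : matching_game -> R) :
      \sum_t (t == t0)%:R * F t = F t0.
    rewrite (bigD1 t0)//= eqxx mul1r big1 ?addr0// => t /negPf ->.
    by rewrite mul0r.
  case: s ph => [[] [b'|]] ph /=.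
  - have [_ _ off] := strategyP l1 ph erefl.
    rewrite big1// => -[[] [b''|]] _; last by rewrite /phi fN /=; ring.
    1-3: by rewrite off ?mul0r.
  - rewrite (mless _ h0 _ ph ph0 erefl) (sumE (phi (true, None))) /phi !fE /=.
    have pf : p false = 1 - p true by rewrite -p1 addrC addKr.
    by rewrite /tau pf; ring.
  - by rewrite last_rcons det /phi /matching_next /= fN; ring.
  - by rewrite last_rcons det /phi /matching_next /= fE -/sigma /m; field.
have := exp0 l2 j; rewrite mxE rmorph0 (@ae_integral_MP _ _ _ _ j m); last first.
  apply: (@filterS _ _ FF _ _ _ (strong_law phi0)) => x x0.
  apply: MP_average_cvg.
  apply: (@average_cvg _ _ (fun i => phi (x i) (x i.+1)) (fun i => pot (x i)) m
    (\sum_s `|pot s|) 0) => //.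
  - by move=> i; rewrite (bigD1 (x i))//= lerDl sumr_ge0.
  - by move=> i _; rewrite /phi /f /=; ring.
by rewrite lee_fin /m pmulr_lge0 ?invr_gt0.
Qed.

(** Adding the inequalities for bit [true] in dimension 0 and bit [false] in dimension 1 cancels the
    contribution of player 1 and leaves 0 <= -2. *)
Lemma matching_not_memoryless (l1 : strategy R matching_game P1) :
  memoryless l1 -> ~ expectation_MP l1 0.
Proof.
move=> mless /(matching_memoryless_value mless)[p [p0 p1 val]].
have := val true ord0; have := val false (lift ord0 ord0).
rewrite /= !expr0 !expr1 !expr2; have := p0 true; have := p0 false; lra.
Qed.

End MatchingGame.

Theorem lemma15 (R : realType) :
  (forall (k : nat) (G : parity_game k), one_player G ->
   forall (v : 'rV[rat]_k) (alpha : R) (beta : 'rV[rat]_k),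
     0 <= alpha <= 1 ->
     (exists l1 : strategy R G P1,
        [/\ pure_finite_memory l1,
            satisfaction l1 alpha (@MeanPayoff k G R v `&` @Parity k G)
          & expectation_MP l1 beta]) ->
     exists l1 : strategy R G P1,
       [/\ memoryless l1,
           satisfaction l1 alpha (@MeanPayoff k G R v `&` @Parity k G)
         & expectation_MP l1 beta])
  /\
  (exists (G : game 2) (beta : 'rV[rat]_2),
     [/\ ~ one_player G,
         exists l1 : strategy R G P1,
           pure_finite_memory l1 /\ expectation_MP l1 beta
       & forall l1 : strategy R G P1,
           memoryless l1 -> ~ expectation_MP l1 beta]).
Proof.
split=> [k G G1 v alpha beta /andP[_ a1] [l1 [fm sat expe]]|].
  exact: one_player_memoryless sat expe.
exists matching_game, 0; split.
- by move=> /(_ (false, None)).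
- have [l1 enc] := @moore_strategy_exists R _ _ P1 matching_machine
    (fun m s _ => matching_next_edge (~~ m) s).
  by exists l1; split; [exists matching_machine|exact: matching_expectation0].
- by move=> l1; exact: matching_not_memoryless.
Qed.
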